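(* For every Banach space $X$ there exist a Gurariĭ space $G$ of the same density as $X$ and a linear isometric embedding of $X$ into $G$.
   Context: All Banach spaces are real. The density of a Banach space is the least infinite cardinality of a dense subset (so every separable Banach space has density $\aleph_0$). For $\varepsilon>0$, a linear operator $f\colon X\to Y$ between Banach spaces is an $\varepsilon$-isometric embedding if $(1+\varepsilon)^{-1}\|x\|\leq\|f(x)\|\leq(1+\varepsilon)\|x\|$ for every $x\in X\setminus\{0\}$; isometric embeddings are always linear. A Banach space $X$ is Gurariĭ if for every pair of finite-dimensional Banach spaces $S\subseteq T$, every isometric embedding $f\colon S\to X$ and every $\varepsilon>0$, there exists an $\varepsilon$-isometric embedding $g\colon T\to X$ with $g\restriction S=f$. *)

(* Defs.v *)
From HB Require Import structures.
From mathcomp Require Import all_boot all_order all_algebra.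
From mathcomp Require Import all_classical all_reals all_analysis.

Set Implicit Arguments.
Unset Strict Implicit.
Unset Printing Implicit Defensive.

Import Order.TTheory GRing.Theory Num.Theory.
Import numFieldNormedType.Exports.

Local Open Scope classical_set_scope.
Local Open Scope card_scope.
Local Open Scope ring_scope.

(* [Vector.axiom n V] is the type of linear bijections from [V] onto R^n. *)
Definition finite_dimensional (R : realType) (V : normedModType R) : Prop :=
  exists n : nat, inhabited (Vector.axiom n V).

Definition isometric_embedding (R : realType) (X Y : normedModType R)
    (f : {linear X -> Y}) : Prop :=
  forall x : X, `|f x| = `|x|.

Definition eps_isometric_embedding (R : realType) (eps : R)
    (X Y : normedModType R) (f : {linear X -> Y}) : Prop :=
  forall x : X, x != 0 ->
    (1 + eps)^-1 * `|x| <= `|f x| /\ `|f x| <= (1 + eps) * `|x|.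

(* A pair [S] included in [T] is given by two Banach spaces together with the
   inclusion map [i], a linear isometric embedding; the restriction of [g] to
   [S] is then the composite of [g] with [i]. *)
Definition gurarii (R : realType) (X : completeNormedModType R) : Prop :=
  forall (S T : completeNormedModType R) (i : {linear S -> T}),
    finite_dimensional S -> finite_dimensional T -> isometric_embedding i ->
  forall f : {linear S -> X}, isometric_embedding f ->
  forall eps : R, 0 < eps ->
  exists g : {linear T -> X},
    eps_isometric_embedding eps g /\ (forall s : S, g (i s) = f s).

(* Cardinals are represented by sets in arbitrary types, up to [#=].  The
   comparison [D #<= K], rather than [D #= K], only matters for the zero space:
   it has no infinite dense subset, but, being separable, it has density
   aleph_0. *)
Definition has_dense_subset_le (R : realType) (X : normedModType R)
    (U : Type) (K : set U) : Prop :=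
  exists D : set X, dense D /\ D #<= K.

Definition is_density (R : realType) (X : normedModType R)
    (U : Type) (K : set U) : Prop :=
  [/\ infinite_set K,
      has_dense_subset_le X K &
      forall (V : Type) (L : set V),
        infinite_set L -> has_dense_subset_le X L -> K #<= L].

Definition same_density (R : realType) (X Y : normedModType R) : Prop :=
  exists (U : Type) (K : set U), is_density X K /\ is_density Y K.

(* Main.v *)
Require Import Defs.
From HB Require Import structures.
From mathcomp Require Import all_boot all_order all_algebra.
From mathcomp Require Import all_classical all_reals all_analysis.
From mathcomp Require Import ring lra.

(** The Gurarii space is built in one go, as a space of functions on a set of
    prospective functionals, so that neither pushouts nor a direct limit nor a
    completion is needed.

    Fix a dense family [b : A -> X], with [A] as small as possible.  A [code]
    is a finite expression made of atoms [a : A], rational combinations, and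
    the instruction [Ext d] to add a point lying in all the balls of a finite
    list [d] of balls whose centres are codes and whose radii are rational.  A
    [point] is a functional in the unit ball of the dual of [X] together with
    an arbitrary real number for each code.  Every code denotes a bounded
    function on points: an atom [a] is evaluated by the functional at [b a],
    and [Ext d] takes at a given point the real number which that point
    proposes, provided that it lies in all the intervals cut out by the balls of
    [d], and some other element of their intersection otherwise.  This makes
    sense as soon as any two of the balls are at a distance compatible with
    their radii, because pairwise intersecting intervals of the line have a
    common element.  The space [generated b] is the uniform closure of the set
    of these functions: a Banach space containing [X] isometrically, with a
    dense subset no larger than the set of codes.

    What makes it work is [eval_functional]: every functional [f] of norm at
    most one on the generated space is the evaluation at some point, namely the
    one that proposes [f c] for the code [c].  Moreover the number proposed for
    [Ext d] may be chosen at will inside the intervals without changing the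
    values of the centres, which are smaller expressions.  Hence the new point
    [w] is as far from the rest as possible: if a functional [f] and a real [s]
    satisfy [|s - f v| <= r] for all balls [(v, r)] of [d], then [f] can be
    altered, away from the centres, into a functional taking [w] to [s].  This
    is the property [ball_extension], proved for the generated space in
    [generated_ball_extension].

    That property implies that the space is Gurarii
    ([gurarii_of_ball_extension]).  Partial maps from [T] to [G] that distort
    norms by a factor at most [l] are extended one vector [u] at a time, at the
    price of an arbitrarily small increase of [l].  The image [w] of [u] is
    obtained from the balls of radius [l * |u - t|] around the images of the
    points [t] of a finite net: they give the upper bound on the distance from
    [w], while the Hahn-Banach theorem, used in [T] to norm [u - t] and in [G]
    to transport the norming functional, gives the lower bound.

    Finally the density is preserved because an infinite set [L] has as many
    elements as the set of codes over it, which rests on the existence of an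
    injection of [L * L] into [L] ([infinite_pairing]), and because passing to a
    subspace does not increase the density. *)

Set Implicit Arguments.
Unset Strict Implicit.
Unset Printing Implicit Defensive.

Import Order.TTheory GRing.Theory Num.Theory.
Import numFieldNormedType.Exports.

Local Open Scope classical_set_scope.
Local Open Scope card_scope.
Local Open Scope ring_scope.

(** * Maximal sets and cardinal arithmetic *)

Lemma Zorn_above (T : Type) (P : set (set T)) (A0 : set T) : P A0 ->
    (forall F : set (set T), F !=set0 -> F `<=` P -> total_on F subset ->
      P (\bigcup_(A in F) A)) ->
  exists A, [/\ P A, A0 `<=` A & forall B, A `<=` B -> P B -> B = A].
Proof.
move=> PA0 Pcup.
pose Q : set (set T) := [set A | P (A0 `|` A)].
have [F FQ Ftot|A [QA Amax]] := @Zorn_bigcup T Q.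
  have [->|/set0P[B FB]] := eqVneq F set0.
    by rewrite /Q /= bigcup_set0 setU0.
  pose F' := [set A0 `|` A | A in F].
  have -> : Q (\bigcup_(X in F) X) = P (\bigcup_(X in F') X).
    rewrite /Q /=; congr P; apply/seteqP; split=> [x [A0x|[A FA Ax]]|x [_ [A FA <-]]].
    - by exists (A0 `|` B); [exists B|left].
    - by exists (A0 `|` A); [exists A|right].
    - by move=> [A0x|Ax]; [left|right; exists A].
  apply: Pcup; first by exists (A0 `|` B), B.
    by move=> _ [A FA <-]; exact: FQ.
  move=> _ _ [A FA <-] [C FC <-].
  by have [AC|CA] := Ftot _ _ FA FC; [left|right]; exact: setUS.
exists (A0 `|` A); split=> // B AB PB.
apply: contrapT => BA; apply: (Amax B).
  split=> [x Ax|BsubA]; first by apply: AB; right.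
  by apply: BA; apply/seteqP; split=> // x /BsubA; right.
by rewrite /Q /= setUidr// => x A0x; apply: AB; left.
Qed.

Lemma inj_card_leP (T U : Type) (A : set T) (B : set U) (f : T -> U) :
  (forall x, A x -> B (f x)) ->
  (forall x y, A x -> A y -> f x = f y -> x = y) -> A #<= B.
Proof.
move=> fAB finj; have injf : set_inj A f.
  by move=> x y /set_mem Ax /set_mem Ay; exact: finj.
have : f @` A #= A by exact: inj_card_eq.
rewrite card_eq_le => /andP[_ /card_le_trans]; apply.
by apply: subset_card_le => _ [x Ax <-]; exact: fAB.
Qed.

Lemma card_le_injP (T U : Type) (A : set T) (B : set U) (u : U) : A #<= B ->
  exists f : T -> U, (forall x, A x -> B (f x)) /\
    (forall x y, A x -> A y -> f x = f y -> x = y).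
Proof.
move=> AB.
elim/Ppointed: U => U in u B AB *; first by case: (no u).
have /pcard_leP[f] := AB.
exists f; split; first by move=> x Ax; exact: funS.
by move=> x y Ax Ay; apply: inj; exact/mem_set.
Qed.

(** A maximal family of choice functions that differ pairwise at every index
    must exhaust some [D i], for otherwise a choice function avoiding all of its
    values could be added; that [D i] then injects into every [D j]. *)
Lemma card_le_min (I T : Type) (i0 : I) (D : I -> set T) :
  exists i, forall j, D i #<= D j.
Proof.
pose P (A : set (I -> T)) := forall s, A s ->
  (forall i, D i (s i)) /\ forall s', A s' -> forall i, s i = s' i -> s = s'.
have [//|F _ FP Ftot|A [PA _ Amax]] := @Zorn_above _ P set0.
  move=> s [A FA As]; split=> [i|s' [B FB Bs'] i]; first by case: (FP _ FA _ As).
  have [AB|BA] := Ftot _ _ FA FB.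
    by have [_] := FP _ FB _ (AB _ As); exact.
  by have [_] := FP _ FA _ As; apply; exact: BA.
have [i Ai] : exists i, forall x, D i x -> exists2 s, A s & s i = x.
  apply: contrapT => /forallNP /= nA.
  have /choice[s sP] : forall i, exists x, D i x /\ forall s, A s -> s i <> x.
    move=> i; have /existsNP[x /not_implyP[Dx nx]] := nA i.
    by exists x; split=> // s As six; apply: nx; exists s.
  have PsA : P (s |` A).
    move=> r [->|Ar]; split=> [i|r' [->|Ar'] i //].
    - by case: (sP i).
    - by move=> e; case: (sP i) => _ /(_ _ Ar'); rewrite e.
    - by case: (PA _ Ar).
    - by case: (sP i) => _ /(_ _ Ar).
    - by case: (PA _ Ar) => _; apply.
  have As : A s by rewrite -(Amax _ _ PsA); [left|move=> r Ar; right].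
  by case: (sP i0) => _ /(_ _ As).
exists i => j.
have [[s0 _]|A0] := pselect (A !=set0); last first.
  suff -> : D i = set0 by exact: card_ge0.
  by apply/seteqP; split=> // x /Ai[s As _]; case: A0; exists s.
have /choice[f fP] : forall x, exists s, D i x -> A s /\ s i = x.
  move=> x; have [/Ai[s As sx]|nD] := pselect (D i x); first by exists s.
  by exists s0.
apply: (@inj_card_leP _ _ _ _ (fun x => f x j)) =>
  [x /fP[Af _]|x y /fP[Ax xE] /fP[Ay yE]].
  by case: (PA _ Af).
by move=> e; rewrite -xE -yE; case: (PA _ Ax) => _ /(_ _ Ay j e) ->.
Qed.

Lemma card_le_total (T : Type) (A B : set T) : A #<= B \/ B #<= A.
Proof.
have [b Hb] := @card_le_min bool T true (fun b => if b then A else B).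
by case: b Hb => Hb; [left; exact: (Hb false)|right; exact: (Hb true)].
Qed.

Definition pairing_on (T : Type) (L : set T) (h : T -> T -> T) :=
  (forall x y, L x -> L y -> L (h x y)) /\
  (forall x y x' y', L x -> L y -> L x' -> L y' ->
    h x y = h x' y' -> x = x' /\ y = y').

(** Cardinal arithmetic says that [L * L] has the cardinality of [L].  A
    maximal pairing is taken among those defined on subsets [B] of [L] that
    contain a fixed countable set.  If [L] minus [B] injects into [B], the
    pairing on [B] induces one on [L]; otherwise a disjoint copy of [B] inside
    [L] has room for the values of a pairing on a larger set. *)
Lemma infinite_pairing (T : Type) (L : set T) : infinite_set L ->
  exists h, pairing_on L h.
Proof.
move=> Linf; have [t0 _] := infinite_setN0 Linf.
have /infiniteP/(card_le_injP t0)[e [eL einj]] := Linf.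
have {}einj m n : e m = e n -> m = n by exact: einj.
have {}eL n : L (e n) by exact: eL.
pose dom (F : set (T * T * T)) x := exists z, F ((x, x), z).
(* A pairing is represented by a total injective relation on its domain, so that
   a chain of pairings has its union as an upper bound; the values are chosen
   once a maximal relation is found. *)
pose P (F : set (T * T * T)) :=
  [/\ forall x y z, F ((x, y), z) -> [/\ dom F x, dom F y, dom F z & L x],
      forall x y, dom F x -> dom F y -> exists z, F ((x, y), z) &
      forall p q z, F (p, z) -> F (q, z) -> p = q].
pose F0 := [set p : T * T * T |
  exists m n, p = ((e m, e n), e (pickle (m, n)))].
have domF0 n : dom F0 (e n) by exists (e (pickle (n, n))), n, n.
have [||F [[FL Fdom Finj] F0F Fmax]] := @Zorn_above _ P F0.
- split=> [x y z [m [n [-> -> ->]]]|x y|p q z [m [n [-> ->]]] [m' [n' [->]]]].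
  + by split; [exact: domF0|exact: domF0|exact: domF0|exact: eL].
  + case=> z [m [_ [-> _ _]]] [z' [n [_ [-> _ _]]]].
    by exists (e (pickle (m, n))), m, n.
  + by move=> /einj/(pcan_inj pickleK)[-> ->].
- move=> S [F1 SF1] SP Stot.
  have two A B : S A -> S B -> exists C, [/\ S C, A `<=` C & B `<=` C].
    by move=> SA SB; have [AB|BA] := Stot _ _ SA SB; [exists B; split|exists A; split].
  have domS A x : S A -> dom A x -> dom (\bigcup_(F in S) F) x.
    by move=> SA [z Az]; exists z, A.
  split=> [x y z [A SA Axyz]|x y [z [A SA Az]] [z' [B SB Bz]]|p q z [A SA Ap] [B SB Bq]].
  + by have [/(_ _ _ _ Axyz)[? ? ? ?] _ _] := SP _ SA; split=> //; exact: (domS A).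
  + have [C [SC AC BC]] := two _ _ SA SB.
    have [_ Cdom _] := SP _ SC.
    have [||w Cw] := Cdom x y; [by exists z; exact: AC|by exists z'; exact: BC|].
    by exists w, C.
  + have [C [SC AC BC]] := two _ _ SA SB.
    by have [_ _ Cinj] := SP _ SC; exact: (Cinj p q z (AC _ Ap) (BC _ Bq)).
pose B := dom F.
have BL x : B x -> L x by move=> [z /FL[]].
have Be n : B (e n) by have [z Fz] := domF0 n; exists z; exact: F0F.
have /choice[h' h'P] : forall p, exists z, B p.1 -> B p.2 -> F (p, z).
  move=> [x y] /=; have [[Bx By]|nB] := pselect (B x /\ B y).
    by have [z Fz] := Fdom _ _ Bx By; exists z.
  by exists t0 => Bx By; case: nB.
pose h x y := h' (x, y).
have hB x y : B x -> B y -> B (h x y).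
  by move=> Bx By; have := h'P (x, y) Bx By; move=> /FL[].
have hinj x y x' y' : B x -> B y -> B x' -> B y' -> h x y = h x' y' ->
    x = x' /\ y = y'.
  move=> Bx By Bx' By' hE; have := h'P (x, y) Bx By; rewrite -/(h x y) hE.
  by move=> /Finj/(_ (h'P (x', y') Bx' By'))[].
(* The elements [e n] of [B] tag the pieces of a disjoint union, here and
   below. *)
have [LB|BLB] := card_le_total (L `\` B) B.
  have [g [gB ginj]] := card_le_injP t0 LB.
  pose c x := if pselect (B x) then h (e 0) x else h (e 1) (g x).
  have cB x : L x -> B (c x).
    rewrite /c; case: pselect => [Bx|nBx] Lx; first exact: hB.
    by apply: hB => //; exact: gB.
  have cinj x y : L x -> L y -> c x = c y -> x = y.
    rewrite /c; case: pselect => Bx; case: pselect => By Lx Ly /hinj.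
    - by move=> /(_ (Be _) Bx (Be _) By)[].
    - by move=> /(_ (Be _) Bx (Be _))[|/einj//]; exact: gB.
    - by move=> /(_ (Be _) _ (Be _) By)[|/einj//]; exact: gB.
    - by move=> /(_ (Be _) _ (Be _))[||_]; [exact: gB|exact: gB|exact: ginj].
  exists (fun x y => h (c x) (c y)); split=> [x y Lx Ly|x y x' y' Lx Ly Lx' Ly'].
    by apply/BL/hB; exact: cB.
  by move=> /hinj[||||/cinj-> // /cinj->] //; exact: cB.
have [f [fB finj]] := card_le_injP t0 BLB.
pose phi (i : bool) a := if i then f a else a.
pose F' := F `|` [set p : T * T * T | exists i j a b, [/\ i || j, B a, B b &
  p = ((phi i a, phi j b), f (h (e (i + j.*2)%N) (h a b)))]].
suff PF' : P F'.
  have FF' : F' = F by apply: Fmax => // p Fp; left.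
  have : F' ((f (e 0), f (e 0)), f (h (e 3) (h (e 0) (e 0)))).
    by right; exists true, true, (e 0), (e 0).
  by rewrite FF' => /FL[[z Fz] _ _ _]; have [_] := fB _ (Be 0); case; exists z.
have domF' i a : B a -> dom F' (phi i a).
  move=> Ba; case: i => /=.
    by exists (f (h (e 3) (h a a))); right; exists true, true, a, a.
  by case: Ba => z Fz; exists z; left.
have domF'P x : dom F' x -> exists i a, B a /\ x = phi i a.
  move=> [z [Fz|[i [j [a [b [_ Ba Bb [-> _ _]]]]]]]]; last by exists i, a.
  by exists false, x; split=> //; exists z.
have philL i a : B a -> L (phi i a).
  by move=> Ba; case: i => /=; [have [] := fB _ Ba|exact: BL].
have phiinj i j a b : B a -> B b -> phi i a = phi j b -> i = j /\ a = b.
  case: i; case: j => Ba Bb /=; [by move=> /finj-> | | |by []].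
    by move=> E; have [_] := fB _ Ba; rewrite E.
  by move=> E; have [_] := fB _ Bb; rewrite -E.
split.
- move=> x y z [Fxyz|[i [j [a [b [ij Ba Bb [-> -> ->]]]]]]].
    have [Bx By Bz Lx] := FL _ _ _ Fxyz.
    by split=> //; [exact: (domF' false)|exact: (domF' false)|exact: (domF' false)].
  split; [exact: domF'|exact: domF'| |exact: philL].
  by apply: (domF' true); do 2?apply: (hB) => //.
- move=> _ _ /domF'P[i [a [Ba ->]]] /domF'P[j [b [Bb ->]]].
  have [ij|nij] := boolP (i || j).
    by exists (f (h (e (i + j.*2)%N) (h a b))); right; exists i, j, a, b.
  move: nij; case: i => //; case: j => // _ /=.
  by have [z Fz] := Fdom _ _ Ba Bb; exists z; left.
- have FnF x y z : F ((x, y), z) -> B z by move=> /FL[].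
  move=> [x y] [x' y'] z [Fp|[i [j [a [b [ij Ba Bb [-> -> zE]]]]]]].
    move=> [Fq|[i [j [a [b [ij Ba Bb [_ _ zE]]]]]]]; first exact: Finj Fp Fq.
    have [|_] := fB (h (e (i + j.*2)%N) (h a b)); first by do 2?apply: (hB) => //.
    by case; rewrite -zE; exact: FnF Fp.
  move=> [Fq|[i' [j' [a' [b' [ij' Ba' Bb' [-> -> zE']]]]]]].
    have [|_] := fB (h (e (i + j.*2)%N) (h a b)); first by do 2?apply: (hB) => //.
    by case; rewrite -zE; exact: FnF Fq.
  have Bh m c d : B c -> B d -> B (h (e m) (h c d)).
    by move=> Bc Bd; apply: (hB) => //; exact: hB.
  move: zE; rewrite zE' => /(finj _ _ (Bh _ _ _ Ba' Bb') (Bh _ _ _ Ba Bb)).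
  move=> /(hinj _ _ _ _ (Be _) (hB _ _ Ba' Bb') (Be _) (hB _ _ Ba Bb))[/einj tE].
  move=> /(hinj _ _ _ _ Ba' Bb' Ba Bb)[-> ->].
  suff [-> ->] : i = i' /\ j = j' by [].
  by move: tE; case: (i); case: (j); case: (i'); case: (j').
Qed.

(** * Linear relations and the Hahn-Banach theorem *)

Section LinearRelations.
Variables (R : realType) (V W : lmodType R).
Implicit Types A : set (V * W).

(** Partial linear maps are handled through their graphs: extension by one
    vector is then [adjoin], with no subspace type and no well-definedness to
    check until the graph is everywhere defined. *)
Definition linear_rel A :=
  A 0 /\ forall (a : R) p q, A p -> A q -> A (a *: p + q).

Lemma linear_relZ A a p : linear_rel A -> A p -> A (a *: p).
Proof. by move=> [A0 AD] Ap; rewrite -[_ *: _]addr0; exact: AD. Qed.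

Lemma linear_relD A p q : linear_rel A -> A p -> A q -> A (p + q).
Proof. by move=> [A0 AD] Ap Aq; rewrite -[p]scale1r; exact: AD. Qed.

Lemma linear_relB A p q : linear_rel A -> A p -> A q -> A (p - q).
Proof. by move=> [A0 AD] Ap Aq; rewrite addrC -scaleN1r; exact: AD. Qed.

Definition adjoin A (p : V * W) : set (V * W) :=
  [set q | exists a : R, A (q - a *: p)].

Lemma sub_adjoin A p : A `<=` adjoin A p.
Proof. by move=> q Aq; exists 0; rewrite scale0r subr0. Qed.

Lemma mem_adjoin A p : linear_rel A -> adjoin A p p.
Proof. by move=> [A0 _]; exists 1; rewrite scale1r subrr. Qed.

Lemma linear_adjoin A p : linear_rel A -> linear_rel (adjoin A p).
Proof.
move=> lA; split; first by apply: sub_adjoin; case: lA.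
move=> a q r [b Ab] [c Ac]; exists (a * b + c).
rewrite scalerDl opprD addrACA -scalerA -scalerBr.
by case: lA => _ AD; exact: AD.
Qed.

Lemma linear_rel_fun A : linear_rel A ->
    (forall v, exists w, A (v, w)) -> (forall w, A (0, w) -> w = 0) ->
  exists f : {linear V -> W}, forall v, A (v, f v).
Proof.
move=> lA /choice[f fA] A0.
have fun_eq v w : A (v, w) -> w = f v.
  move=> Aw; apply/eqP; rewrite -subr_eq0; apply/eqP/A0.
  by have := linear_relB lA Aw (fA v); rewrite /= -[(v, w) - _]/(v - v, w - f v) subrr.
have flin : linear f.
  move=> a u v; apply/esym/fun_eq; case: lA => _ AD.
  exact: (AD a _ _ (fA u) (fA v)).
pose fL := GRing.isLinear.Build R V W _ f flin.
pose F : {linear V -> W} := HB.pack f fL.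
by exists F.
Qed.

End LinearRelations.

(** A maximal dominated relation is everywhere defined: the values allowed at
    a new vector [u] form the intersection of the intervals of centre [r] and
    radius [|v - u|], which meet pairwise, and their supremum of left ends is
    such a value. *)
Lemma Hahn_Banach (R : realType) (V : normedModType R) (A : set (V * R^o)) :
    linear_rel A -> (forall v r, A (v, r) -> `|r| <= `|v|) ->
  exists f : {linear V -> R^o},
    (forall v r, A (v, r) -> f v = r) /\ forall v, `|f v| <= `|v|.
Proof.
move=> lA Anorm.
pose P (B : set (V * R^o)) :=
  linear_rel B /\ forall v r, B (v, r) -> `|r| <= `|v|.
have [//||B [[lB Bnorm] AB Bmax]] := @Zorn_above _ P A.
  move=> S [F SF] SP Stot; split; last by move=> v r [C /SP[_]]; exact.
  split; first by exists F => //; have [[]] := SP _ SF.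
  move=> a p q [C SC Cp] [D SD Dq]; have [CD|DC] := Stot _ _ SC SD.
    by exists D => //; have [[_ +] _] := SP _ SD; apply=> //; exact: CD.
  by exists C => //; have [[_ +] _] := SP _ SC; apply=> //; exact: DC.
have Btot u : exists s, B (u, s).
  pose L := [set p.2 - `|p.1 - u| | p in B].
  have Lub p : B p -> ubound L (p.2 + `|p.1 - u|).
    move=> Bp _ [q Bq <-]; rewrite lerBlDr -addrA -lerBlDl.
    apply: le_trans (ler_norm _) _.
    have -> : `|p.1 - u| + `|q.1 - u| = `|u - p.1| + `|q.1 - u|.
      by rewrite distrC.
    apply: le_trans (Bnorm (q.1 - p.1) (q.2 - p.2) _) _.
      exact: (linear_relB lB Bq Bp).
    by rewrite -[q.1 - p.1](subrKA u) addrC ler_normD.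
  have L0 : L !=set0 by exists (0 - `|0 - u|), 0 => //; case: lB.
  pose s := sup L.
  have sB p : B p -> `|s - p.2| <= `|u - p.1|.
    move=> Bp; rewrite ler_distl distrC; apply/andP; split.
      by apply: ub_le_sup; [exists (p.2 + `|p.1 - u|); exact: Lub|exists p].
    by apply: ge_sup => //; exact: Lub.
  exists s; rewrite -(Bmax (adjoin B (u, s))); first exact: mem_adjoin.
    exact: sub_adjoin.
  split; first exact: linear_adjoin.
  move=> v r [a Ba].
  have [a0|a0] := eqVneq a 0.
    by apply: Bnorm; move: Ba; rewrite a0 scale0r subr0.
  have := sB _ (linear_relZ (- a^-1) lB Ba); rewrite /=.
  have -> : s - - a^-1 *: (r - a *: s) = a^-1 *: r.
    by rewrite scaleNr opprK scalerBr !scalerA mulVf// scale1r addrC subrK.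
  have -> : u - - a^-1 *: (v - a *: u) = a^-1 *: v.
    by rewrite scaleNr opprK scalerBr !scalerA mulVf// scale1r addrC subrK.
  by rewrite !normrZ ler_pM2l// normr_gt0 invr_eq0.
have [|f fB] := linear_rel_fun lB Btot.
  by move=> w /Bnorm; rewrite normr0 normr_le0 => /eqP.
exists f; split=> [v r Avr|v]; last exact: Bnorm.
have := linear_relB lB (fB v) (AB _ Avr).
rewrite -[(v, f v) - _]/(v - v, f v - r) subrr => /Bnorm.
by rewrite normr0 normr_le0 subr_eq0 => /eqP.
Qed.

Lemma norming_functional (R : realType) (V : normedModType R) (v : V) :
  exists f : {linear V -> R^o}, f v = `|v| /\ forall x, `|f x| <= `|x|.
Proof.
pose A : set (V * R^o) := [set p | exists a : R, p = (a *: v, a * `|v|)].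
have [||f [fA fn]] := @Hahn_Banach _ _ A.
- split; first by exists 0; rewrite scale0r mul0r.
  move=> a _ _ [b ->] [c ->]; exists (a * b + c).
  by rewrite scalerDl mulrDl -scalerA -mulrA.
- by move=> _ _ [a [-> ->]]; rewrite !normrZ normr_id.
exists f; split=> //; apply: fA; exists 1.
by rewrite scale1r mul1r.
Qed.

(** * Finite-dimensional spaces *)

Section FiniteDimensional.
Variables (R : realType) (T : normedModType R).
Hypothesis fdT : finite_dimensional T.

Lemma finite_dimensional_basis :
  exists n (g : 'rV[R]_n -> T) (e : 'I_n -> T),
    [/\ linear g, forall t, exists c, g c = t, forall c, g c = 0 -> c = 0 &
        forall c, g c = \sum_j c 0 j *: e j].
Proof.
have [n [[v2r vlin [g vK gK]]]] := fdT.
have glin : linear g.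
  by move=> a c d; apply: (can_inj vK); rewrite vlin !gK.
pose gM := GRing.isLinear.Build _ _ _ _ g glin.
pose gL : {linear 'rV[R]_n -> T} := HB.pack g gM.
exists n, g, (fun j => g (delta_mx 0 j)); split=> //.
- by move=> t; exists (v2r t); rewrite vK.
- by move=> c gc; apply: (can_inj gK); rewrite gc -[g]/(gL : _ -> _) linear0.
- move=> c; rewrite {1}[c]row_sum_delta -[g]/(gL : _ -> _) linear_sum.
  by apply: eq_bigr => j _; rewrite linearZ.
Qed.

Lemma finite_net (W : set T) (M eta : R) : (forall t, W t -> `|t| <= M) ->
    0 < eta ->
  exists ts : seq T, (forall t, t \in ts -> W t) /\
    forall t, W t -> exists2 t', t' \in ts & `|t - t'| <= eta.
Proof.
move=> WM eta0.
have [n [g [e [glin gsurj ginj gE]]]] := finite_dimensional_basis.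
have gcont : continuous g.
  have -> : g = fun c => \sum_j c 0 j *: e j by exact/funext.
  apply: continuous_big => [|j _ c]; first exact: add_continuous.
  by apply: continuousZr_tmp; exact: coord_continuous.
have g0 : g 0 = 0 by rewrite gE big1// => j _; rewrite mxE scale0r.
have gZ a c : g (a *: c) = a *: g c by rewrite -[a *: c]addr0 glin g0 addr0.
(* The coordinate norm is dominated by the norm of [T], because the latter has
   a positive minimum on the unit sphere of the coordinates. *)
have [m m0 gm] : exists2 m : R, 0 < m & forall c, m * `|c| <= `|g c|.
  pose S := [set c : 'rV[R]_n | `|c| = 1].
  have toS c : c != 0 -> S (`|c|^-1 *: c).
    by move=> c0; rewrite /S /= normrZ normfV normr_id mulVf// normr_eq0.
  have [S0|/set0P S0] := eqVneq S set0.
    exists 1 => // c; have [->|/toS] := eqVneq c 0.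
      by rewrite normr0 mulr0.
    by rewrite S0.
  have [||c /set_mem Sc cmin] := @EVT_min_rV R n (fun c => `|g c|) S S0.
  - apply: bounded_closed_compact.
      by exists 1; split=> // x x1 c /= ->; exact: ltW.
    have -> : S = Num.norm @^-1` [set x | x = 1] by [].
    by apply: closed_comp => [c _|]; [exact: norm_continuous|exact: closed_eq].
  - apply: continuous_subspaceT => c.
    by apply: continuous_comp; [exact: gcont|exact: norm_continuous].
  exists `|g c|.
    rewrite normr_gt0; apply/eqP => /ginj c0.
    by move: Sc; rewrite /S /= c0 normr0 => /esym/eqP; rewrite oner_eq0.
  move=> d; have [->|d0] := eqVneq d 0; first by rewrite normr0 mulr0.
  have := cmin _ (mem_set (toS _ d0)).
  by rewrite gZ normrZ normfV normr_id mulrC ler_pdivlMr ?normr_gt0// mulrC.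
pose B := [set c : 'rV[R]_n | `|c| <= M / m].
have cB : compact (g @` B).
  apply: continuous_compact; first exact: continuous_subspaceT.
  apply: bounded_closed_compact.
    exists (M / m); split=> [|x /ltW Mx c /le_trans]; last exact.
    by rewrite num_real.
  have -> : B = Num.norm @^-1` [set x | x <= M / m] by [].
  by apply: closed_comp => [c _|]; [exact: norm_continuous|exact: closed_le].
move: cB; rewrite compact_cover => cB.
have [||F _ Fcov] := cB T setT (fun t => ball t (eta / 2)).
- by move=> t _; exact: ball_open.
- by move=> t _; exists t => //; apply: ballxx; rewrite divr_gt0.
have /finite_seqP[fs fsE] := finite_fset F; rewrite fsE in Fcov.
have /choice[p pP] : forall t, exists w,
    (exists2 w, W w & ball t (eta / 2) w) -> W w /\ ball t (eta / 2) w.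
  move=> t; have [[w Ww tw]|N] := pselect (exists2 w, W w & ball t (eta / 2) w).
    by exists w.
  by exists t => /N.
exists [seq p t | t <- fs & `[< exists2 w, W w & ball t (eta / 2) w >]].
split=> [_ /mapP[t + ->]|w Ww].
  by rewrite mem_filter => /andP[/asboolP/pP[]].
have [|t tF tw] := Fcov w.
  have [c cw] := gsurj w; exists c => //.
  by rewrite /B /= ler_pdivlMr// mulrC (le_trans (gm _))// cw; exact: WM.
have ew : exists2 w, W w & ball t (eta / 2) w by exists w.
exists (p t); first by apply: map_f; rewrite mem_filter tF andbT; exact/asboolP.
have [_] := pP _ ew; move: tw; rewrite -!ball_normE /= => tw tp.
rewrite -[w](subrK t) -addrA (le_trans (ler_normD _ _))// [eta]splitr.
by rewrite lerD ?ltW// distrC.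
Qed.

End FiniteDimensional.

(** * A metric criterion for being Gurarii *)

Section BallExtension.
Variables (R : realType).

(** Any finite list of balls that are pairwise close enough to meet has an
    almost common point [w], which moreover is almost as far from the centres as
    is compatible with the balls: every real [s] that could be the value at [w]
    of an extension of the functional [f], judging from the balls, is almost
    taken into account by the norm. *)
Definition ball_extension (G : normedModType R) : Prop :=
  forall (d : seq (G * R)) (eps : R), 0 < eps ->
    (forall p q, p \in d -> q \in d -> `|p.1 - q.1| <= p.2 + q.2) ->
  exists w : G, forall p, p \in d -> `|w - p.1| <= p.2 + eps /\
    forall (f : {linear G -> R^o}) (s : R^o), (forall x, `|f x| <= `|x|) ->
      (forall q, q \in d -> `|s - f q.1| <= q.2) ->
      `|s - f p.1| <= `|w - p.1| + eps.

Variables (T : completeNormedModType R) (G : completeNormedModType R).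
Implicit Types A : set (T * G).

Definition bilipschitz (l : R) A :=
  forall p, A p -> `|p.1| <= l * `|p.2| /\ `|p.2| <= l * `|p.1|.

Lemma bilipschitz_adjoin l A u w : linear_rel A -> bilipschitz l A ->
    (forall p, A p -> `|u - p.1| <= l * `|w - p.2| /\
                      `|w - p.2| <= l * `|u - p.1|) ->
  bilipschitz l (adjoin A (u, w)).
Proof.
move=> lA lbA lbw [t x] [a Aa].
have [a0|a0] := eqVneq a 0.
  by apply: (lbA (t, x)); move: Aa; rewrite a0 scale0r subr0.
have := lbw _ (linear_relZ (- a^-1) lA Aa); rewrite /=.
have aux (V : lmodType R) (y z : V) : y - - a^-1 *: (z - a *: y) = a^-1 *: z.
  by rewrite scaleNr opprK scalerBr !scalerA mulVf// scale1r addrC subrK.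
by rewrite !aux !normrZ ![l * _]mulrCA !ler_pM2l// normr_gt0 invr_eq0.
Qed.

(** A vector in the closure of the domain needs no new freedom: its image is
    forced to be the limit of the images of approximating vectors. *)
Lemma adjoin_near (l : R) A (u : T) :
    0 <= l -> linear_rel A -> bilipschitz l A ->
    (forall e, 0 < e -> exists2 p, A p & `|u - p.1| < e) ->
  exists w, bilipschitz l (adjoin A (u, w)).
Proof.
move=> l0 lA lbA uA.
have /choice[p pP] : forall n, exists p, A p /\ `|u - p.1| < n.+1%:R^-1.
  by move=> n; have [|p Ap up] := uA n.+1%:R^-1; [rewrite invr_gt0|exists p].
have xdist m n : `|(p m).2 - (p n).2| <= l * (m.+1%:R^-1 + n.+1%:R^-1).
  have [[Am um] [An un]] := (pP m, pP n).
  have [_ /le_trans] := lbA _ (linear_relB lA Am An); apply.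
  apply: ler_wpM2l => //; rewrite /= -[(p m).1 - _](subrKA u).
  by rewrite (le_trans (ler_normD _ _))// lerD ?ltW// distrC.
have /cvg_ex[w pw] : cvg ((fun n => (p n).2) @ \oo).
  apply: cauchy_cvg; apply/cauchyP => e e0.
  have e20 : 0 < e / (2 * (l + 1)) by rewrite divr_gt0// mulr_gt0// ltr_wpDl.
  near \oo => N; exists (p N).2.
  have Ne : N.+1%:R^-1 < e / (2 * (l + 1)).
    by near: N; exact: near_infty_natSinv_lt (PosNum e20).
  exists N => // n /= Nn; rewrite -ball_normE /=.
  have nN : n.+1%:R^-1 <= N.+1%:R^-1 :> R by rewrite lef_pV2 ?posrE// ler_nat.
  apply: le_lt_trans (xdist _ _) _.
  apply: (@le_lt_trans _ _ (l * (N.+1%:R^-1 + N.+1%:R^-1))).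
    by rewrite ler_wpM2l// lerD.
  move: Ne; rewrite ltr_pdivlMr ?mulr_gt0 ?ltr_wpDl// => Ne.
  have N0 : 0 < N.+1%:R^-1 :> R by rewrite invr_gt0.
  by move: (N.+1%:R^-1 : R) N0 Ne => y; lra.
exists w; apply: bilipschitz_adjoin => // q Aq.
have lim (V : normedModType R) (y : nat -> V) v c : y @ \oo --> v ->
    `|y n - c| @[n --> \oo] --> `|v - c|.
  by move=> yv; apply: cvg_norm; apply: cvgB => //; exact: cvg_cst.
have pu : (fun n => (p n).1) @ \oo --> u.
  apply/cvgrPdist_lt => e e0; near=> n.
  have [_ /lt_trans] := pP n; apply; near: n.
  exact: near_infty_natSinv_lt (PosNum e0).
have [lim1 lim2] := (lim _ _ _ q.1 pu, lim _ _ _ q.2 pw).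
have scale_lim (y : nat -> R) v : y @ \oo --> v -> l * y n @[n --> \oo] --> l * v.
  by move=> yv; apply: cvgM => //; exact: cvg_cst.
split; [apply: (ler_cvg_to lim1 (scale_lim _ _ lim2))|
  apply: (ler_cvg_to lim2 (scale_lim _ _ lim1))].
  by near=> n; have [An _] := pP n; have [] := lbA _ (linear_relB lA An Aq).
by near=> n; have [An _] := pP n; have [] := lbA _ (linear_relB lA An Aq).
Unshelve. all: by end_near. Qed.

(** The point [w] given by the balls of radius [l * |u - t|] around the images
    of finitely many vectors [t] satisfies the estimates up to a small error for
    these [t], hence for all the [t] of bounded norm by density of the net.  For
    large [t] the error is a constant, which is small compared with
    [|u - t|]. *)
Lemma adjoin_far (l k dist : R) A (u : T) :
    finite_dimensional T -> ball_extension G ->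
    1 <= l -> l < k -> linear_rel A -> bilipschitz l A ->
    0 < dist -> (forall p, A p -> dist <= `|u - p.1|) ->
  exists w, bilipschitz k (adjoin A (u, w)).
Proof.
move=> fdT extG l1 lk lA lbA dist0 distA.
have l0 : 0 < l by exact: lt_le_trans l1.
have k0 : 0 < k by exact: lt_trans lk.
pose th := Num.min (k - l) (l^-1 - k^-1).
have th0 : 0 < th by rewrite lt_min !subr_gt0 lk ltf_pV2.
have thk : l + th <= k by rewrite -lerBrDl ge_min lexx.
have thV : k^-1 + th <= l^-1 by rewrite -lerBrDl ge_min lexx orbT.
have lV0 : 0 < l^-1 by rewrite invr_gt0.
have lV1 : l^-1 <= 1 by rewrite invf_le1.
(* Beyond the norm [N], the constant error [2 * l * |u| + eps] is at most
   [th * |u - t|]; within it, [eta] and [eps] make the error at most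
   [th * dist], and [dist] is a lower bound for [|u - t|]. *)
pose N := `|u| + (2 * l * `|u| + 1) / th.
pose eps := Num.min 1 (th * dist / 2).
pose eta := th * dist / (4 * l).
have eps0 : 0 < eps by rewrite lt_min ltr01 divr_gt0 ?mulr_gt0.
have eps1 : eps <= 1 by rewrite ge_min lexx.
have eps2 : eps <= th * dist / 2 by rewrite ge_min lexx orbT.
have eta0 : 0 < eta by rewrite divr_gt0 ?mulr_gt0.
have etaE : 2 * l * eta = th * dist / 2.
  by rewrite /eta; field; rewrite gt_eqF.
pose W := [set t : T | (exists x, A (t, x)) /\ `|t| <= N].
have [t [] // |ts [tsW tsnet]] := finite_net fdT (W := W) (M := N) _ eta0.
have /choice[x xA] : forall t, exists x, W t -> A (t, x).
  by move=> t; have [[[x Ax] _]|nW] := pselect (W t); [exists x|exists 0].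
pose ps := (0 : T * G) :: [seq (t, x t) | t <- ts].
have psA p : p \in ps -> A p.
  rewrite inE => /orP[/eqP->|/mapP[t /tsW/xA Ax ->] //]; by case: lA.
pose ball_at p : G * R := (p.2, l * `|u - p.1|).
pose D := map ball_at ps.
have [|w wP] := extG D eps eps0.
  move=> _ _ /mapP[p /psA Ap ->] /mapP[q /psA Aq ->] /=.
  have [_ /le_trans] := lbA _ (linear_relB lA Ap Aq); apply.
  rewrite -mulrDr; apply: ler_wpM2l; first exact: ltW.
  by rewrite /= -[p.1 - _](subrKA u) (le_trans (ler_normD _ _))// lerD// distrC.
have upper p : p \in ps -> `|w - p.2| <= l * `|u - p.1| + eps.
  by move=> pps; have [] := wP _ (map_f ball_at pps).
have lower p : p \in ps -> l^-1 * `|u - p.1| <= `|w - p.2| + eps.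
  move=> pps; have [_] := wP _ (map_f ball_at pps).
  (* The functional norming [u - p.1], divided by [l] to make up for the
     distortion of [A], is carried over to [G] along [A] and extended. *)
  have [psi [psiu psin]] := norming_functional (u - p.1).
  pose B : set (G * R^o) := [set q | exists2 r, A r & q = (r.2, l^-1 *: psi r.1)].
  have [||phi [phiB phin]] := @Hahn_Banach _ _ B.
  - split.
      exists 0; first by case: lA.
      by congr pair; rewrite -[LHS](scaler0 _ l^-1) -(linear0 psi).
    move=> a _ _ [q Aq ->] [r Ar ->]; exists (a *: q + r); first by case: lA => _; apply.
    rewrite -[RHS]/(a *: q.2 + r.2, l^-1 *: psi (a *: q.1 + r.1)).
    by rewrite linearP scalerDr !scalerA [_ * a]mulrC -scalerA.
  - move=> y z [q Aq [-> ->]]; rewrite normrZ gtr0_norm// ler_pdivrMl//.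
    by rewrite (le_trans (psin _))//; case: (lbA _ Aq).
  have phiE q : A q -> phi q.2 = l^-1 *: psi q.1 by move=> Aq; apply: phiB; exists q.
  have sE q : A q -> `|l^-1 *: psi u - phi q.2| = l^-1 * `|psi (u - q.1)|.
    by move=> Aq; rewrite phiE// -scalerBr -linearB normrZ gtr0_norm.
  move=> /(_ phi (l^-1 *: psi u) phin); rewrite /= sE; last exact: psA.
  rewrite psiu normr_id; apply=> y /mapP[q qps ->{y}] /=.
  rewrite sE; last exact: psA.
  apply: ler_pM => //; first exact: ltW.
  exact: le_trans lV1 l1.
have near_bound p : A p -> exists C : R, [/\ C <= th * `|u - p.1|,
    `|w - p.2| <= l * `|u - p.1| + C & l^-1 * `|u - p.1| <= `|w - p.2| + C].
  move=> Ap; have [pN|pN] := leP `|p.1| N.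
    have [|t tts pt] := tsnet p.1; first by split=> //; exists p.2; case: (p) Ap.
    have tps : (t, x t) \in ps by rewrite inE map_f ?orbT.
    have [+ +] := (upper _ tps, lower _ tps).
    have [_] := lbA _ (linear_relB lA Ap (psA _ tps)); rewrite /= => px up lo.
    exists (2 * l * eta + eps).
    have lp : l * `|p.1 - t| <= l * eta by rewrite ler_wpM2l// ltW.
    have thD : th * dist <= th * `|u - p.1| by rewrite ler_wpM2l ?distA// ltW.
    split.
    - by move: thD etaE eps2; lra.
    - have : `|w - p.2| <= `|w - x t| + `|p.2 - x t|.
        by rewrite -[w - p.2](subrKA (x t)) [`|p.2 - _|]distrC ler_normD.
      have : l * `|u - t| <= l * (`|u - p.1| + `|p.1 - t|).
        by rewrite ler_wpM2l ?(ltW l0)// -[u - t](subrKA p.1) ler_normD.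
      by move: lp up px; lra.
    - have : `|w - x t| <= `|w - p.2| + `|p.2 - x t|.
        by rewrite -[w - x t](subrKA p.2) ler_normD.
      have : l^-1 * `|u - p.1| <= l^-1 * (`|u - t| + `|p.1 - t|).
        by rewrite ler_wpM2l ?(ltW lV0)// -[u - p.1](subrKA t) [`|p.1 - t|]distrC ler_normD.
      have : l^-1 * `|p.1 - t| <= l * `|p.1 - t|.
        by rewrite ler_wpM2r// (le_trans lV1).
      by move: lp lo px; lra.
  have [_] := lbA _ Ap.
  exists (2 * l * `|u| + eps).
  have zps : (0 : T * G) \in ps by rewrite inE eqxx.
  have := upper _ zps; rewrite !subr0 => w0.
  have [lbA1 lbA2] := lbA _ Ap.
  have up : `|u| <= `|u - p.1| + `|p.1| by rewrite -{1}[u](subrK p.1) ler_normD.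
  have pu : `|p.1| <= `|u - p.1| + `|u|.
    by rewrite -{1}[p.1](subrK u) [`|u - _|]distrC ler_normD.
  split.
  - have : (2 * l * `|u| + 1) / th < `|u - p.1| by move: pN pu; rewrite /N; lra.
    by rewrite ltr_pdivrMr// mulrC; move: eps1; lra.
  - have : `|w - p.2| <= `|w| + `|p.2| by rewrite (le_trans (ler_normD _ _))// normrN.
    have : l * `|p.1| <= l * (`|u - p.1| + `|u|) by rewrite ler_wpM2l// ltW.
    by move: w0 lbA2; lra.
  - have : `|p.2| <= `|w - p.2| + `|w|.
      by rewrite -{1}[p.2](subrK w) [`|w - _|]distrC ler_normD.
    have : l^-1 * `|u - p.1| <= l^-1 * (`|u| + `|p.1|).
      by rewrite ler_wpM2l ?(ltW lV0)// (le_trans (ler_normD _ _))// normrN.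
    have : l^-1 * `|u| <= l * `|u| by rewrite ler_wpM2r// (le_trans lV1).
    have : l^-1 * `|p.1| <= `|p.2| by rewrite ler_pdivrMl.
    by move: w0; lra.
have leM (a b c : R) : a <= b -> 0 <= c -> a * c <= b * c.
  by move=> ab c0; rewrite ler_wpM2r.
exists w; apply: bilipschitz_adjoin => //.
  move=> q Aq; have [q1 q2] := lbA _ Aq.
  have lkle := ltW lk.
  by split; [apply: le_trans q1 _|apply: le_trans q2 _]; rewrite ler_wpM2r.
move=> p Ap; have [C [C1 C2 C3]] := near_bound p Ap; split.
  rewrite -ler_pdivrMl//.
  by have := leM _ _ `|u - p.1| thV (normr_ge0 _); move: C1 C3; lra.
by have := leM _ _ `|u - p.1| thk (normr_ge0 _); move: C1 C2; lra.
Qed.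

Lemma extend_vector (l k : R) A (u : T) :
    finite_dimensional T -> ball_extension G ->
    1 <= l -> l < k -> linear_rel A -> bilipschitz l A ->
  exists w, bilipschitz k (adjoin A (u, w)).
Proof.
move=> fdT extG l1 lk lA lbA.
have [near_u|] := pselect (forall e, 0 < e -> exists2 p, A p & `|u - p.1| < e).
  have l0 : 0 <= l by exact: le_trans l1.
  have [w lw] := adjoin_near l0 lA lbA near_u.
  exists w => p /lw[p1 p2]; have lkle := ltW lk.
  by split; [apply: le_trans p1 _|apply: le_trans p2 _]; rewrite ler_wpM2r.
move=> /existsNP[e /not_implyP[e0 /forall2NP far_u]].
apply: (adjoin_far fdT extG l1 lk lA lbA e0) => p Ap.
by case: (far_u p) => // /negP; rewrite -leNgt.
Qed.

Lemma extend_vectors (us : seq T) (l k : R) A :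
    finite_dimensional T -> ball_extension G ->
    1 <= l -> l < k -> linear_rel A -> bilipschitz l A ->
  exists B, [/\ A `<=` B, linear_rel B, bilipschitz k B &
    forall u, u \in us -> exists x, B (u, x)].
Proof.
move=> fdT extG; elim: us l A => [|u us IH] l A l1 lk lA lbA.
  exists A; split=> // p /lbA[p1 p2]; have lkle := ltW lk.
  by split; [apply: le_trans p1 _|apply: le_trans p2 _]; rewrite ler_wpM2r.
have [lm mk] := midf_lt lk.
have [w lbw] := extend_vector u fdT extG l1 lm lA lbA.
have [|B [AB lB lbB usB]] := IH _ _ _ mk (linear_adjoin (u, w) lA) lbw.
  by rewrite (le_trans l1)// ltW.
exists B; split=> // [p Ap|v]; first by apply: AB; exact: sub_adjoin.
rewrite inE => /orP[/eqP->|/usB//].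
by exists w; apply: AB; exact: mem_adjoin.
Qed.

End BallExtension.

(** Starting from the graph of [f] over [i], one extends over the vectors of a
    basis of [T]; the resulting relation is defined everywhere. *)
Theorem gurarii_of_ball_extension (R : realType) (G : completeNormedModType R) :
  ball_extension G -> gurarii G.
Proof.
move=> extG S T i _ fdT iiso f fiso eps eps0.
have [n [g [e [glin gsurj ginj gE]]]] := finite_dimensional_basis fdT.
pose A : set (T * G) := [set p | exists s, p = (i s, f s)].
have lA : linear_rel A.
  split; first by exists 0; congr pair; rewrite linear0.
  by move=> a _ _ [s ->] [t ->]; exists (a *: s + t); rewrite !linearP.
have lbA : bilipschitz 1 A by move=> _ [s ->]; rewrite /= iiso fiso mul1r.
have eps1 : 1 < 1 + eps by rewrite ltrDl.
have [B [AB lB lbB eB]] :=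
  extend_vectors [seq e j | j <- enum 'I_n] fdT extG (lexx 1) eps1 lA lbA.
have Btot t : exists x, B (t, x).
  have [c <-] := gsurj t; rewrite gE; apply: (big_ind (fun t => exists x, B (t, x))).
  - by exists 0; case: lB.
  - by move=> t1 t2 [x1 B1] [x2 B2]; exists (x1 + x2); exact: (linear_relD lB B1 B2).
  - move=> j _; have [|x Bx] := eB (e j); first by apply: map_f; rewrite mem_enum.
    by exists (c 0 j *: x); exact: (linear_relZ _ lB Bx).
have [|h hB] := linear_rel_fun lB Btot.
  by move=> x /lbB[_]; rewrite /= normr0 mulr0 normr_le0 => /eqP.
exists h; split=> [t t0|s].
  have [h1 h2] := lbB _ (hB t); split=> //.
  by rewrite ler_pdivrMl// (lt_trans _ eps1).
apply/eqP; rewrite -subr_eq0 -normr_le0.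
have [_] := lbB _ (linear_relB lB (hB (i s)) (AB _ (ex_intro _ s erefl))).
by rewrite /= subrr normr0 mulr0.
Qed.

(** * Banach spaces of bounded functions *)

(** The point ensures that the supremum defining the norm is taken over a
    nonempty set. *)
Record closed_function_space (R : realType) (K : Type) := ClosedFunctionSpace {
  fspace_set : set (K -> R^o);
  fspace_point : K;
  fspace0 : fspace_set (fun=> 0);
  fspaceD : forall (a : R) f g, fspace_set f -> fspace_set g ->
    fspace_set (fun k => a * f k + g k);
  fspace_bounded : forall f, fspace_set f -> exists M : R, forall k, `|f k| <= M;
  fspace_closed : forall f, (forall e : R, 0 < e -> exists2 g, fspace_set g &
    forall k, `|f k - g k| <= e) -> fspace_set f }.

Section FunctionSpace.
Variables (R : realType) (K : Type) (W : closed_function_space R K).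

Definition fspace_pred : pred (K -> R^o) := fun f => `[< fspace_set W f >].

Definition fspace := {f : K -> R^o | fspace_pred f}.

HB.instance Definition _ := SubChoice.on fspace.

Lemma fspace_submod : subsemimod_closed fspace_pred.
Proof.
have D a f g : f \in fspace_pred -> g \in fspace_pred -> a *: f + g \in fspace_pred.
  by move=> /asboolP Wf /asboolP Wg; apply/asboolP; exact: fspaceD.
have Z0 : 0 \in fspace_pred by apply/asboolP; exact: fspace0.
split; first split => //.
  by move=> f g Wf Wg; rewrite -[f]scale1r; exact: D.
by move=> a f Wf; rewrite -[_ *: _]addr0; exact: D.
Qed.

HB.instance Definition _ :=
  GRing.SubChoice_isSubLmodule.Build R (K -> R^o) fspace_pred fspace fspace_submod.

Definition sup_norm (f : fspace) : R := sup (range (fun k => `|val f k|)).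

Lemma fspaceP (f : fspace) : fspace_set W (val f).
Proof. exact/asboolP/(valP f). Qed.

Lemma le_sup_norm (f : fspace) k : `|val f k| <= sup_norm f.
Proof.
have [M fM] := fspace_bounded (fspaceP f).
by apply: ub_le_sup; [exists M => _ [j _ <-]|exists k].
Qed.

Lemma sup_norm_le (f : fspace) (M : R) :
  (forall k, `|val f k| <= M) -> sup_norm f <= M.
Proof.
move=> fM; apply: ge_sup; last by move=> _ [k _ <-].
by exists `|val f (fspace_point W)|, (fspace_point W).
Qed.

Lemma sup_normD f g : sup_norm (f + g) <= sup_norm f + sup_norm g.
Proof.
apply: sup_norm_le => k; rewrite (le_trans (ler_normD _ _))//.
by rewrite lerD// le_sup_norm.
Qed.

Lemma sup_normZ a f : sup_norm (a *: f) = `|a| * sup_norm f.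
Proof.
have le b g : sup_norm (b *: g) <= `|b| * sup_norm g.
  apply: sup_norm_le => k; rewrite -[val _ k]/(b * val g k) normrM.
  by rewrite ler_wpM2l// le_sup_norm.
apply/eqP; rewrite eq_le le/=.
have [->|a0] := eqVneq a 0.
  rewrite normr0 mul0r (le_trans _ (le_sup_norm _ (fspace_point W)))//.
rewrite -ler_pdivlMl ?normr_gt0// -normfV.
by rewrite -{1}[f]scale1r -(mulVf a0) -scalerA.
Qed.

Lemma sup_norm_eq0 f : sup_norm f = 0 -> f = 0.
Proof.
move=> f0; apply/val_inj/funext => k; apply/eqP.
by rewrite -normr_le0 -f0 le_sup_norm.
Qed.

HB.instance Definition _ :=
  Lmodule_isNormed.Build R fspace sup_normD sup_normZ sup_norm_eq0.

(** The pointwise limit of a Cauchy filter is taken as a supremum along the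
    centres [c n] of small balls of the filter, shifted down by their radii. *)
Lemma fspace_cauchy_cvg (F : set_system fspace) :
  ProperFilter F -> cauchy F -> cvg F.
Proof.
move=> FF /cauchyP Fc.
have /choice[c cP] : forall n, exists x, F (ball x n.+1%:R^-1).
  by move=> n; exact: Fc.
have val_ball (x y : fspace) e k : ball x e y -> `|val x k - val y k| <= e.
  rewrite -ball_normE /= => /ltW; apply: le_trans.
  exact: (le_sup_norm (x - y)).
have cc m n k : `|val (c m) k - val (c n) k| <= m.+1%:R^-1 + n.+1%:R^-1.
  have [y [ym yn]] := filter_ex (filterI (cP m) (cP n)).
  rewrite -[_ - _](subrKA (val y k)) (le_trans (ler_normD _ _))//.
  by apply: lerD; [exact: val_ball|rewrite distrC; exact: val_ball].
pose f k := sup (range (fun n => val (c n) k - n.+1%:R^-1)).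
have fc n k : `|f k - val (c n) k| <= n.+1%:R^-1.
  have ub m : val (c m) k - m.+1%:R^-1 <= val (c n) k + n.+1%:R^-1.
    by rewrite lerBlDr -addrA -lerBlDl addrC (le_trans (ler_norm _))// cc.
  rewrite ler_distl; apply/andP; split.
    by apply: ub_le_sup; [exists (val (c n) k + n.+1%:R^-1) => _ [m _ <-]|exists n].
  apply: ge_sup; last by move=> _ [m _ <-].
  by exists (val (c 0) k - 1%:R^-1), 0.
have small (e : R) : 0 < e -> exists n, n.+1%:R^-1 <= e.
  move=> e0; near \oo => n; exists n; apply/ltW.
  by near: n; exact: near_infty_natSinv_lt (PosNum e0).
have Wf : fspace_set W f.
  apply: fspace_closed => e e0; have [n ne] := small e e0.
  exists (val (c n)) => [|k]; first exact: fspaceP.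
  exact: le_trans (fc _ _) ne.
pose fs : fspace := exist _ f (asboolT Wf).
apply/cvg_ex; exists fs; apply/cvgrPdist_le => e e0.
have [|n ne] := small (e / 2); first by rewrite divr_gt0.
near=> t; apply: sup_norm_le => k.
have ct : ball (c n) n.+1%:R^-1 t by near: t; exact: cP.
rewrite -[val _ k]/(f k - val t k) -[_ - _](subrKA (val (c n) k)).
rewrite (le_trans (ler_normD _ _))// [e]splitr.
by apply: lerD; apply: le_trans ne; [exact: fc|exact: val_ball].
Unshelve. all: by end_near. Qed.

HB.instance Definition _ := Uniform_isComplete.Build fspace fspace_cauchy_cvg.

End FunctionSpace.

(** * The generated space *)

(** [Comb q c1 c2] stands for [q c1 + c2]. *)
Inductive code (A : Type) : Type :=
  | Atom of A
  | Comb of rat & code A & code A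
  | Ext of balls A
with balls (A : Type) : Type :=
  | Nil
  | Cons of code A & rat & balls A.
Arguments Nil {A}.

Scheme code_balls_ind := Induction for code Sort Prop
  with balls_code_ind := Induction for balls Sort Prop.
Combined Scheme code_balls_mutind from code_balls_ind, balls_code_ind.

Fixpoint code_size (A : Type) (c : code A) : nat :=
  match c with
  | Atom _ => 0
  | Comb _ c1 c2 => (code_size c1 + code_size c2).+1
  | Ext d => (balls_size d).+1
  end
with balls_size (A : Type) (d : balls A) : nat :=
  match d with
  | Nil => 0
  | Cons c _ d' => (code_size c + balls_size d')%N
  end.

Section Clip.
Variable R : realType.
Implicit Types (s : R) (l : seq (R * R)).

(** In the second case the supremum of the left ends is an element common to
    all the intervals, when they meet pairwise. *)
Definition clip s l : R :=
  if `[< forall p, p \in l -> `|s - p.1| <= p.2 >] then s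
  else sup [set p.1 - p.2 | p in [set` l]].

Lemma clip_id s l : (forall p, p \in l -> `|s - p.1| <= p.2) -> clip s l = s.
Proof. by move=> sl; rewrite /clip asboolT. Qed.

Lemma clip_in s l p : p \in l ->
    (forall p q, p \in l -> q \in l -> `|p.1 - q.1| <= p.2 + q.2) ->
  `|clip s l - p.1| <= p.2.
Proof.
move=> pl lE; rewrite /clip; case: ifPn => [/asboolP|_]; first exact.
have ub q : q \in l -> ubound [set p.1 - p.2 | p in [set` l]] (q.1 + q.2).
  move=> ql _ [r /= rl <-]; rewrite lerBlDr -addrA -lerBlDl (le_trans (ler_norm _))//.
  by rewrite [q.2 + _]addrC lE.
rewrite ler_distl; apply/andP; split.
  by apply: ub_le_sup; [exists (p.1 + p.2); exact: ub|exists p].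
by apply: ge_sup; [exists (p.1 - p.2), p|exact: ub].
Qed.

End Clip.

Section Generated.
Variables (R : realType) (X : normedModType R) (A : Type) (b : A -> X).

Record point := Point {
  point_dual : {linear X -> R^o};
  point_dual_le : forall x, `|point_dual x| <= `|x|;
  point_free : code A -> R }.

Definition admissible (l : seq ((point -> R) * R)) : Prop := l <> [::] /\
  forall p q, p \in l -> q \in l -> forall k, `|p.1 k - q.1 k| <= p.2 + q.2.

(** The test of admissibility quantifies over all points, not only over the
    given one: it concerns the distances between the centres in the space under
    construction, which are known by then as the centres are subexpressions. *)
Fixpoint eval (c : code A) : point -> R :=
  match c with
  | Atom a => fun k => point_dual k (b a)
  | Comb q c1 c2 => fun k => ratr q * eval c1 k + eval c2 k
  | Ext d => fun k =>
      if `[< admissible (eval_balls d) >]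
      then clip (point_free k (Ext d)) [seq (p.1 k, p.2) | p <- eval_balls d]
      else 0
  end
with eval_balls (d : balls A) : seq ((point -> R) * R) :=
  match d with
  | Nil => [::]
  | Cons c r d' => (eval c, ratr r) :: eval_balls d'
  end.

Definition balls_of (l : seq (code A * rat)) : balls A :=
  foldr (fun p => Cons p.1 p.2) Nil l.

Lemma eval_balls_of l :
  eval_balls (balls_of l) = [seq (eval p.1, ratr p.2) | p <- l].
Proof. by elim: l => //= p l ->. Qed.

Lemma eval_ExtP d p k : admissible (eval_balls d) -> p \in eval_balls d ->
  `|eval (Ext d) k - p.1 k| <= p.2.
Proof.
move=> dadm pd; rewrite /= asboolT//.
apply: (@clip_in _ _ _ (p.1 k, p.2)); first exact: (map_f (fun p => (p.1 k, p.2))).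
by move=> _ _ /mapP[q qd ->] /mapP[r rd ->] /=; case: dadm => _; exact.
Qed.

Lemma eval_bounded : forall c, exists M : R, forall k, `|eval c k| <= M.
Proof.
suff [+ _] : (forall c, exists M : R, forall k, `|eval c k| <= M) /\
  (forall d p, p \in eval_balls d -> exists M : R, forall k, `|p.1 k| <= M) by [].
apply: (@code_balls_mutind A) => //.
- by move=> a; exists `|b a| => k; exact: point_dual_le.
- move=> q c1 [M1 cM1] c2 [M2 cM2]; exists (`|ratr q| * M1 + M2) => k /=.
  by rewrite (le_trans (ler_normD _ _))// lerD// normrM ler_wpM2l.
- move=> d dM; have [dadm|ndadm] := pselect (admissible (eval_balls d)); last first.
    by exists 0 => k /=; rewrite asboolF// normr0.
  have [p pd] : exists p, p \in eval_balls d.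
    by case: dadm => + _; case: eval_balls => // p l _; exists p; rewrite mem_head.
  have [M pM] := dM _ pd; exists (p.2 + M) => k.
  rewrite -[eval _ k](subrK (p.1 k)) (le_trans (ler_normD _ _))// lerD//.
  exact: eval_ExtP.
- move=> c [M cM] r d dM p /=; rewrite inE => /orP[/eqP->|/dM//].
  by exists M.
Qed.

Lemma null_point : point.
Proof.
apply: (@Point (\0 : {linear X -> R^o}) _ (fun=> 0)) => x.
by rewrite [X in `|X|](_ : _ = 0)// normr0.
Qed.

(** The elements already form a rational vector space, because of [Comb], so
    that the closure is a real one. *)
Definition generated_set : set (point -> R^o) :=
  [set f | forall e : R, 0 < e -> exists c, forall k, `|f k - eval c k| <= e].

Lemma generated_eval c : generated_set (eval c).
Proof. by move=> e /ltW e0; exists c => k; rewrite subrr normr0. Qed.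

Lemma generated0 : generated_set (fun=> 0).
Proof.
(* An empty list of balls is not admissible, so [Ext Nil] denotes zero. *)
move=> e /ltW e0; exists (Ext Nil) => k /=.
by rewrite asboolF ?subrr ?normr0//; case.
Qed.

Lemma generated_bounded f :
  generated_set f -> exists M : R, forall k, `|f k| <= M.
Proof.
move=> /(_ 1 ltr01)[c fc]; have [M cM] := eval_bounded c; exists (1 + M) => k.
by rewrite -[f k](subrK (eval c k)) (le_trans (ler_normD _ _))// lerD.
Qed.

Lemma generatedD (a : R) f g : generated_set f -> generated_set g ->
  generated_set (fun k => a * f k + g k).
Proof.
move=> Wf Wg e e0.
have [M fM] := generated_bounded Wf.
have e3 : 0 < e / 3 by rewrite divr_gt0.
have M0 : 0 <= M by exact: le_trans (fM null_point).
have [q qa] : exists q : rat, `|a - ratr q| * M <= e / 3.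
  have [] := @dense_rat R (ball a (e / 3 / (M + 1))).
  - by exists a; apply: ballxx; rewrite divr_gt0// ltr_wpDl.
  - exact: ball_open.
  move=> x [+ [q _ qx]]; rewrite -{}qx -ball_normE /= ltr_pdivlMr ?ltr_wpDl// => qa.
  exists q; apply: le_trans (ltW qa).
  by rewrite ler_wpM2l// lerDl.
have q0 : 0 < `|ratr q : R| + 1 by rewrite ltr_wpDl.
have [c cf] := Wf _ (divr_gt0 e3 q0); have [c' cg] := Wg _ e3.
exists (Comb q c c') => k /=.
have -> : a * f k + g k - (ratr q * eval c k + eval c' k) =
    (a - ratr q) * f k + ratr q * (f k - eval c k) + (g k - eval c' k) by ring.
have -> : e = e / 3 + e / 3 + e / 3 by field.
rewrite (le_trans (ler_normD _ _))// lerD// (le_trans (ler_normD _ _))// lerD//.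
  by rewrite normrM (le_trans _ qa)// ler_wpM2l.
rewrite normrM; have := cf k; rewrite ler_pdivlMr// => cfk.
apply: le_trans cfk.
by rewrite mulrC ler_wpM2l// lerDl.
Qed.

Lemma generated_closed (f : point -> R^o) :
  (forall e : R, 0 < e -> exists2 g, generated_set g &
    forall k, `|f k - g k| <= e) -> generated_set f.
Proof.
move=> fW e e0; have e2 : 0 < e / 2 by rewrite divr_gt0.
have [g /(_ _ e2)[c gc] fg] := fW _ e2; exists c => k.
rewrite -[f k - _](subrKA (g k)) [e]splitr (le_trans (ler_normD _ _))//.
exact: lerD.
Qed.

Definition generated_space := ClosedFunctionSpace
  null_point generated0 generatedD generated_bounded generated_closed.

Definition generated : completeNormedModType R := fspace generated_space.

End Generated.

Section GeneratedTheory.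
Variables (R : realType) (X : normedModType R) (A : Type) (b : A -> X).
Hypothesis b_dense : forall (x : X) (e : R), 0 < e -> exists a, `|x - b a| <= e.
Local Notation G := (generated b).
Local Notation point := (point X A).

Lemma generated_distP (f g : G) (M : R) :
  `|f - g| <= M <-> forall k : point, `|val f k - val g k| <= M.
Proof.
split=> [fg k|fg]; last exact: (@sup_norm_le _ _ _ (f - g)).
exact: le_trans (le_sup_norm (f - g) k) fg.
Qed.

Definition element (c : code A) : G :=
  exist _ (eval b c) (asboolT (generated_eval b c)).

Lemma element_dense (x : G) (e : R) : 0 < e -> exists c, `|x - element c| <= e.
Proof.
move=> e0; have xW : generated_set b (val x) := fspaceP x.
have [c xc] := xW e e0.
by exists c; apply/generated_distP.
Qed.

Lemma generated_dual (x : X) :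
  generated_set b (fun k : point => point_dual k x).
Proof.
move=> e e0; have [a xa] := b_dense x e0; exists (Atom a) => k /=.
by rewrite -linearB (le_trans (point_dual_le k _)).
Qed.

Lemma embedding_exists : exists i : {linear X -> G},
  isometric_embedding i /\ forall x k, val (i x) k = point_dual k x.
Proof.
pose i x : G := exist _ (fun k : point => point_dual k x) (asboolT (generated_dual x)).
have ilin : linear i.
  by move=> a x y; apply/val_inj/funext => k; rewrite /= linearP.
pose iM := GRing.isLinear.Build _ _ _ _ i ilin.
pose iL : {linear X -> G} := HB.pack i iM.
exists iL; split=> // x; apply/eqP; rewrite eq_le; apply/andP; split.
  by apply: (@sup_norm_le _ _ _ (i x)) => k; exact: point_dual_le.
have [f [fx fn]] := norming_functional x.
have := le_sup_norm (i x) (Point fn (fun=> 0)).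
by rewrite /= fx normr_id.
Qed.

(** A functional of norm at most one respects the distances between elements,
    so the number [f (element (Ext d))] lies in all the intervals cut out by
    [d], and [clip] leaves it unchanged.  The bound [n] on the size leaves the
    values of [point_free] at larger codes unconstrained. *)
Lemma eval_functional (i : {linear X -> G}) (f : {linear G -> R^o})
    (k : point) n :
    (forall x k, val (i x) k = point_dual k x) ->
    (forall x, `|f x| <= `|x|) ->
    (forall x, point_dual k x = f (i x)) ->
    (forall c, (code_size c <= n)%N -> point_free k c = f (element c)) ->
  forall c, (code_size c <= n)%N -> eval b c k = f (element c).
Proof.
move=> iE fn ki kf.
suff [+ _] : (forall c, (code_size c <= n)%N -> eval b c k = f (element c)) /\
    (forall d, (balls_size d <= n)%N -> forall p, p \in eval_balls b d ->
      exists2 c, p.1 = eval b c & p.1 k = f (element c)) by [].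
apply: (@code_balls_mutind A) => //=.
- move=> a _; rewrite ki; congr (f _); apply/val_inj/funext => j.
  by rewrite iE.
- move=> q c1 IH1 c2 IH2 cn; rewrite IH1; last by rewrite (leq_trans _ (ltnW cn))// leq_addr.
  rewrite IH2; last by rewrite (leq_trans _ (ltnW cn))// leq_addl.
  rewrite -[ratr q * _]/(ratr q *: f (element c1)) -linearP.
  by congr (f _); apply/val_inj/funext.
- move=> d IH dn; have [dadm|ndadm] := pselect (admissible (eval_balls b d));
    last first.
    rewrite asboolF// -[LHS](linear0 f); congr (f _); apply/val_inj/funext => j /=.
    by rewrite asboolF.
  rewrite asboolT// clip_id; first exact: kf.
  move=> _ /mapP[p pd ->] /=; rewrite kf//.
  have [|c pE ->] := IH _ p pd; first exact: ltnW.
  rewrite -linearB (le_trans (fn _))//; apply/generated_distP => j.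
  by rewrite -[val (element c) j]/(eval b c j) -pE; exact: eval_ExtP.
- move=> c IHc r d IHd cdn p; rewrite inE => /orP[/eqP->|pd].
    by exists c => //; apply: IHc; rewrite (leq_trans _ cdn)// leq_addr.
  by apply: IHd => //; rewrite (leq_trans _ cdn)// leq_addl.
Qed.

(** The centres are replaced by elements at distance at most [del] and the
    radii by rationals larger by [del] up to [2 * del], which keeps both the
    compatibility of the balls and that of the given [f] and [s] with them.  The
    point [k] that evaluates to [f] at all small codes and proposes [s] for the
    new one then witnesses the lower bound on the distances. *)
Lemma generated_ball_extension : ball_extension G.
Proof.
move=> d eps eps0 dE.
have [->|dN0] := eqVneq d [::]; first by exists 0.
have [i [iiso iE]] := embedding_exists.
pose del := eps / 4.
have del0 : 0 < del by rewrite divr_gt0.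
have /choice[c cP] : forall p : G * R, exists c, `|p.1 - element c| <= del.
  by move=> p; exact: element_dense.
have /choice[q qP] : forall p : G * R,
    exists q : rat, p.2 + del < ratr q < p.2 + 2 * del.
  move=> p; have [|q /itvP qE] := @rat_in_itvoo R (p.2 + del) (p.2 + 2 * del).
    by rewrite ltrD2l ltr_pMl// ltr1n.
  by exists q; rewrite !qE.
pose D := balls_of [seq (c p, q p) | p <- d].
have DE : eval_balls b D = [seq (eval b (c p), ratr (q p)) | p <- d].
  by rewrite eval_balls_of -map_comp.
have Dadm : admissible (eval_balls b D).
  rewrite DE; split; first by case: (d) dN0.
  move=> _ _ /mapP[p pd ->] /mapP[r rd ->] k /=.
  move: k; apply/(generated_distP (element (c p)) (element (c r))).
  rewrite -[element (c p) - _](subrKA r.1) (le_trans (ler_normD _ _))//.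
  have pr : `|element (c p) - r.1| <= del + (p.2 + r.2).
    rewrite -[_ - r.1](subrKA p.1) (le_trans (ler_normD _ _))// lerD//.
      by rewrite distrC.
    exact: dE.
  rewrite (le_trans (lerD pr (cP r)))//.
  by have [/andP[+ _] /andP[+ _]] := (qP p, qP r); lra.
have DP p k : p \in d -> `|eval b (Ext D) k - eval b (c p) k| <= ratr (q p).
  move=> pd; apply: (@eval_ExtP _ _ _ b D (eval b (c p), ratr (q p))) => //.
  by rewrite DE; exact: (map_f (fun p => (eval b (c p), ratr (q p)))).
exists (element (Ext D)) => p pd.
have tri (x y z : G) : `|x - y| <= `|x - z| + `|y - z|.
  by rewrite -[x - y](subrKA z) [`|y - z|]distrC ler_normD.
split.
  rewrite (le_trans (tri _ _ (element (c p))))//.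
  have wc : `|element (Ext D) - element (c p)| <= ratr (q p).
    by apply/generated_distP => k; exact: DP.
  rewrite (le_trans (lerD wc (cP p)))//.
  by have /andP[_] := qP p; rewrite /del; lra.
move=> f s fn sd.
have fdist r : `|f r.1 - f (element (c r))| <= del.
  by rewrite -linearB (le_trans (fn _)).
have xin x : `|f (i x)| <= `|x| by rewrite -(iiso x).
pose k : point := @Point R X A (f \o i) xin
  (fun c => if pselect (c = Ext D) then s else f (element c)).
have kc r : r \in d -> eval b (c r) k = f (element (c r)).
  move=> rd; apply: (@eval_functional i f k (balls_size D)) => //.
    move=> c' c'D; rewrite /k /=; case: pselect => // c'E.
    by exfalso; move: c'D; rewrite c'E /= ltnn.
  rewrite /D; elim: (d) rd => //= t d' IH; rewrite inE => /orP[/eqP->|/IH rd'].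
    exact: leq_addr.
  by rewrite (leq_trans rd')// leq_addl.
have ks : eval b (Ext D) k = s.
  rewrite /= asboolT// DE clip_id; first by case: pselect.
  case: pselect => // _ _ /mapP[_ /mapP[r rd ->] ->] /=.
  rewrite kc// -[s - f (element _)](subrKA (f r.1)) (le_trans (ler_normD _ _))//.
  rewrite (le_trans (lerD (sd _ rd) (fdist r)))//.
  by have /andP[/ltW] := qP r.
have sc : `|s - f (element (c p))| <= `|element (Ext D) - element (c p)|.
  rewrite -ks -kc//.
  exact: (le_sup_norm (element (Ext D) - element (c p)) k).
rewrite -[s - f p.1](subrKA (f (element (c p)))) (le_trans (ler_normD _ _))//.
rewrite [`|f _ - f p.1|]distrC (le_trans (lerD sc (fdist p)))//.
rewrite (le_trans (lerD (tri _ _ p.1) (lexx del)))// -addrA lerD2l.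
rewrite [`|element (c p) - _|]distrC (le_trans (lerD (cP p) (lexx del)))//.
by rewrite /del; lra.
Qed.

End GeneratedTheory.

(** * Density characters *)

Lemma dense_normP (R : realType) (V : normedModType R) (D : set V) :
  dense D <-> forall (x : V) (e : R), 0 < e -> exists2 d, D d & `|x - d| <= e.
Proof.
split=> [dD x e e0|dD O [x Ox] oO].
  have [||d [xd Dd]] := dD (ball x e); [by exists x; exact: ballxx|exact: ball_open|].
  by exists d => //; move: xd; rewrite -ball_normE => /ltW.
have /nbhs_ballP[e /= e0 xeO] : nbhs x O by exact: open_nbhs_nbhs.
have e2 : 0 < e / 2 by rewrite divr_gt0.
have [d Dd xd] := dD x _ e2; exists d; split=> //; apply: xeO.
by rewrite -ball_normE /= (le_lt_trans xd)// gtr_pMr// invf_lt1// ltr1n.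
Qed.

Fixpoint encode_code (A T : Type) (h : T -> T -> T) (e : nat -> T) (j : A -> T)
    (c : code A) : T :=
  match c with
  | Atom a => h (e 0) (j a)
  | Comb q c1 c2 =>
      h (e 1) (h (e (pickle q)) (h (encode_code h e j c1) (encode_code h e j c2)))
  | Ext d => h (e 2) (encode_balls h e j d)
  end
with encode_balls (A T : Type) (h : T -> T -> T) (e : nat -> T) (j : A -> T)
    (d : balls A) : T :=
  match d with
  | Nil => h (e 0) (e 0)
  | Cons c r d' =>
      h (e 1) (h (encode_code h e j c) (h (e (pickle r)) (encode_balls h e j d')))
  end.

Lemma card_code_le (A T : Type) (L : set T) :
  infinite_set L -> [set: A] #<= L -> [set: code A] #<= L.
Proof.
move=> Linf AL; have [h [hL hinj]] := infinite_pairing Linf.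
have [t0 _] := infinite_setN0 Linf.
have [j [jL jinj]] := card_le_injP t0 AL.
have /infiniteP/(card_le_injP t0)[e [eL einj]] := Linf.
have {}einj m n : e m = e n -> m = n by exact: einj.
have {}eL n : L (e n) by exact: eL.
have {}jinj x y : j x = j y -> x = y by exact: jinj.
have {}jL x : L (j x) by exact: jL.
have [enL enbL] : (forall c, L (encode_code h e j c)) /\
    (forall d, L (encode_balls h e j d)).
  by apply: code_balls_mutind => * /=; auto 8.
apply: (@inj_card_leP _ _ _ _ (encode_code h e j)) => // c c' _ _; move: c c'.
suff [+ _] :
    (forall c c', encode_code h e j c = encode_code h e j c' -> c = c') /\
    (forall d d', encode_balls h e j d = encode_balls h e j d' -> d = d') by [].
have tagE m x n y : L x -> L y -> h (e m) x = h (e n) y -> m = n /\ x = y.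
  by move=> Lx Ly /hinj[//|//|//|//|/einj-> ->].
apply: code_balls_mutind => [a|q c1 IH1 c2 IH2|d IH||c IHc r d IHd].
- move=> [a'|q' c1' c2'|d'] /tagE[||//]; try by auto 8.
  by move=> _ /jinj->.
- move=> [a'|q' c1' c2'|d'] /tagE[||//]; try by auto 8.
  move=> _ /tagE[||/(pcan_inj pickleK)->]; try by auto 8.
  by move=> /hinj[//|//|//|//|/IH1-> /IH2->].
- move=> [a'|q' c1' c2'|d'] /tagE[||//]; try by auto 8.
  by move=> _ /IH->.
- by move=> [//|c' r' d'] /tagE[||//]; auto 8.
- move=> [|c' r' d'] /tagE[||//]; try by auto 8.
  move=> _ /hinj[||||/IHc->]; try by auto 8.
  by move=> /tagE[//|//|/(pcan_inj pickleK)-> /IHd->].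
Qed.

Lemma card_setX_nat_le (T U : Type) (D : set U) (L : set T) :
  infinite_set L -> D #<= L -> D `*` [set: nat] #<= L.
Proof.
move=> Linf DL; have [h [hL hinj]] := infinite_pairing Linf.
have [t0 _] := infinite_setN0 Linf.
have [j [jL jinj]] := card_le_injP t0 DL.
have /infiniteP/(card_le_injP t0)[e [eL einj]] := Linf.
apply: (@inj_card_leP _ _ _ _ (fun p => h (j p.1) (e p.2))) =>
  [p [Dp _]|p q [Dp _] [Dq _]].
  by apply: hL; [exact: jL|exact: eL].
move=> /hinj[||||jE eE]; do ?by [exact: jL|exact: eL].
rewrite [p]surjective_pairing [q]surjective_pairing.
by rewrite (jinj _ _ Dp Dq jE) (einj _ _ I I eE).
Qed.

(** For each [d] of a dense subset of [G] and each [n], one picks a point of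
    [X] whose image is within [1 / (n + 1)] of [d], if there is one. *)
Lemma dense_subset_le_isometric (R : realType) (X G : normedModType R)
    (i : {linear X -> G}) (T : Type) (L : set T) : isometric_embedding i ->
  infinite_set L -> has_dense_subset_le G L -> has_dense_subset_le X L.
Proof.
move=> iiso Linf [D [/dense_normP dD DL]].
have /choice[c cP] : forall p : G * nat, exists x,
    (exists x, `|i x - p.1| <= p.2.+1%:R^-1) -> `|i x - p.1| <= p.2.+1%:R^-1.
  move=> p; have [[x px]|N] := pselect (exists x, `|i x - p.1| <= p.2.+1%:R^-1).
    by exists x.
  by exists 0.
exists (c @` (D `*` setT)); split.
  apply/dense_normP => x eps eps0; have eps2 : 0 < eps / 2 by rewrite divr_gt0.
  near \oo => n.
  have neps : n.+1%:R^-1 < eps / 2.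
    by near: n; exact: near_infty_natSinv_lt (PosNum eps2).
  have [|d Dd xd] := dD (i x) n.+1%:R^-1; first by rewrite invr_gt0.
  exists (c (d, n)); first by exists (d, n).
  have /= cd : `|i (c (d, n)) - (d, n).1| <= (d, n).2.+1%:R^-1 by apply: cP; exists x.
  rewrite -iiso linearB -[i x - _](subrKA d) (le_trans (ler_normD _ _))//.
  rewrite [eps]splitr; apply: lerD; first exact: le_trans xd (ltW neps).
  by rewrite distrC; exact: le_trans cd (ltW neps).
exact: card_le_trans (card_image_le _ _) (card_setX_nat_le Linf DL).
Unshelve. all: by end_near. Qed.

(** The smallest dense subset is multiplied by [nat] because that of the zero
    space is finite. *)
Lemma density_exists (R : realType) (X : normedModType R) :
  exists K : set (X * nat), is_density X K.
Proof.
have dT : dense [set: X].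
  by apply/dense_normP => x e /ltW e0; exists x; rewrite ?subrr ?normr0.
pose I := {D : set X | dense D}.
have [[D dD] Dmin] := @card_le_min I X (exist _ setT dT) sval.
have [x0 Dx0] : D !=set0.
  by move/dense_normP: (dD) => /(_ 0 1 ltr01)[x Dx _]; exists x.
exists (D `*` setT); split.
- apply/infiniteP; apply: (@inj_card_leP _ _ _ _ (fun n => (x0, n))) => //.
  by move=> m n _ _ [].
- exists D; split=> //; apply: (@inj_card_leP _ _ _ _ (fun x => (x, 0%N))) => //.
  by move=> x y _ _ [].
move=> T L Linf [E [dE EL]]; apply: card_setX_nat_le => //.
exact: card_le_trans (Dmin (exist _ E dE)) EL.
Qed.

Theorem theorem3p6 (R : realType) (X : completeNormedModType R) :
  exists G : completeNormedModType R,
    [/\ gurarii G,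
        same_density X G &
        exists i : {linear X -> G}, isometric_embedding i].
Proof.
have [K [Kinf [D [dD DK]] Kmin]] := density_exists X.
pose b (a : D) : X := val a.
have b_dense (x : X) (e : R) : 0 < e -> exists a, `|x - b a| <= e.
  move=> e0; move/dense_normP: dD => /(_ x e e0)[d Dd xd].
  by exists (SigSub (mem_set Dd)).
have [i [iiso _]] := embedding_exists b_dense.
exists (generated b); split.
- exact/gurarii_of_ball_extension/generated_ball_extension.
- exists (X * nat)%type, K; split.
    by split=> //; exists D.
  split=> // [|T L Linf GL].
    exists (range (element b)); split.
      apply/dense_normP => x e e0; have [c xc] := element_dense x e0.
      by exists (element b c).
    apply: card_le_trans (card_image_le _ _) _; apply: card_code_le => //.
    by rewrite (card_le_eql (card_setT D)).
  by apply: Kmin => //; exact: dense_subset_le_isometric iiso Linf GL.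
- by exists i.
Qed.
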